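(* Let $m,d,s$ be positive integers and $q$ a prime power with $d/m<q-1$. Then the multiplicity code $\mathcal{C}(m,d,s,q)$ is a $k$-PIR code $[q^s,n,k]_Q^P$, where $n=\binom{d+s}{s}/\binom{s+m-1}{s}$, $k=\lfloor q/m\rfloor^{s-1}$, and $Q=q^{\binom{s+m-1}{s}}$.
   Context: For $\boldsymbol{i}=(i_1,\dots,i_s)$ a vector of nonnegative integers, $wt(\boldsymbol{i})=\sum_j i_j$. For $P\in\mathbb{F}_q[x_1,\dots,x_s]$, the $\boldsymbol{i}$-th Hasse derivative $P^{(\boldsymbol{i})}(\boldsymbol{x})$ is the coefficient of $\boldsymbol{z}^{\boldsymbol{i}}$ in $P(\boldsymbol{x}+\boldsymbol{z})$. Let $\Sigma=\mathbb{F}_q^{\binom{s+m-1}{s}}$ and $P^{(<m)}(\boldsymbol{w})=(P^{(\boldsymbol{i})}(\boldsymbol{w}))_{wt(\boldsymbol{i})<m}\in\Sigma$. The multiplicity code $\mathcal{C}(m,d,s,q)$ is the $\mathbb{F}_q$-linear code of length $q^s$ over the alphabet $\Sigma$ (of size $Q$), coordinates indexed by $\mathbb{F}_q^s$, consisting of $(P^{(<m)}(\boldsymbol{w}))_{\boldsymbol{w}\in\mathbb{F}_q^s}$ for all $P$ of total degree at most $d$; it is taken in systematic form, so that it encodes $n=\log_Q|\mathcal{C}|$ information symbols. An $[N,n,k]_Q^P$ code ($k$-PIR code) is a code of length $N$ over an alphabet of size $Q$ encoding $n$ information symbols such that for every information symbol $x_i$ there exist $k$ mutually disjoint sets $R_{i,1},\dots,R_{i,k}$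 of coordinates such that, for each $j$, $x_i$ is a function of the codeword symbols in $R_{i,j}$. *)

(* Defs.v *)
From HB Require Import structures.
From mathcomp Require Import all_boot all_order all_algebra all_field.
From mathcomp Require Import mpoly.
Set Implicit Arguments. Unset Strict Implicit. Unset Printing Implicit Defensive.
Import Order.TTheory GRing.Theory Num.Theory.
Local Open Scope ring_scope.

Section MultiplicityCode.
Variables (F : finFieldType) (m d s : nat).

Definition mc_coord := {ffun 'I_s -> F}.

Definition mc_alphabet := {ffun 'X_{1..s < m} -> F}.

Definition mc_word := {ffun mc_coord -> mc_alphabet}.

(* P(x + z), as a polynomial in z = (z_1..z_s) whose coefficients are
   polynomials in x = (x_1..x_s) *)
Definition shiftP (P : {mpoly F[s]}) : {mpoly {mpoly F[s]}[s]} :=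
  (map_mpoly (fun c : F => c%:MP) P)
    \mPo [tuple ('X_i)%:MP + 'X_i | i < s].

Definition hasse (P : {mpoly F[s]}) (i : 'X_{1..s}) : {mpoly F[s]} :=
  (shiftP P)@_i.

Definition hasse_vec (P : {mpoly F[s]}) (w : mc_coord) : mc_alphabet :=
  [ffun i : 'X_{1..s < m} => (hasse P i).@[w]].

Definition mult_encode (P : {mpoly F[s]}) : mc_word :=
  [ffun w => hasse_vec P w].

Definition mult_code (c : mc_word) : Prop :=
  exists P : {mpoly F[s]}, (msize P <= d.+1)%N /\ c = mult_encode P.

End MultiplicityCode.

Definition recoverable_from (T : finType) (A : Type)
    (C : {ffun T -> A} -> Prop) (w : T) (R : {set T}) : Prop :=
  exists g : {ffun T -> A} -> A,
    (forall c c' : {ffun T -> A}, (forall v, v \in R -> c v = c' v) -> g c = g c')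
    /\ (forall c, C c -> g c = c w).

(* k-PIR property for the symbol at every coordinate (in particular for every
   information symbol of any systematic form) *)
Definition PIR_property (T : finType) (A : Type)
    (C : {ffun T -> A} -> Prop) (k : nat) : Prop :=
  forall w : T, exists Rs : 'I_k -> {set T},
    (forall j1 j2, j1 != j2 -> [disjoint Rs j1 & Rs j2]) /\
    (forall j, recoverable_from C w (Rs j)).

(* Main.v *)
(* Let q = #|F| and write recenter w P for P(w + z), whose coefficients are the
   Hasse derivatives of P at w.  All of the recovery statements are about a
   difference P of two codeword polynomials.

   Recovery.  If the derivatives of order < m of P vanish at every point
   w + t b, t <> 0, of a line, then the restriction of P to that line is
   divisible by (T - t)^m for the q - 1 nonzero t; as deg P <= d < m (q - 1), it
   is zero.  Its coefficient of T^j is the form sum_(|i| = j) P^(i)(w) b^i, so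
   letting b range over a grid {1} x A_1 x ... x A_(s-1) with all #|A_i| >= m
   kills every P^(i)(w) with |i| < m.  Cutting F into floor(q/m) disjoint
   blocks of size m gives floor(q/m)^(s-1) disjoint grids of directions, hence
   as many disjoint recovering sets.

   Dimension.  The products of (x_i^q - x_i)^(a_i) x_i^(r_i), r_i < q, form a
   basis of the polynomials which is triangular for the degree.  After
   recentering at w, such a product is z^a times a polynomial with constant term
   (nonzero constant) * w^r.  If P vanishes to order m everywhere and
   deg P < m q, then, by induction on |a|, the coefficient of z^a in P(w + z)
   shows that a reduced polynomial vanishes on all of F^s, hence is zero. *)

Require Import Defs.
From HB Require Import structures.
From mathcomp Require Import all_boot all_order all_algebra all_field.
From mathcomp Require Import mpoly.
Import Order.TTheory GRing.Theory Num.Theory.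

Set Implicit Arguments.
Unset Strict Implicit.
Unset Printing Implicit Defensive.

(** * Interpolation on product grids *)

Section Grid.
Local Open Scope ring_scope.
Variable F : finFieldType.

(** [L] is column [j] of the inverse of the Vandermonde matrix with nodes in [A]: it reads the
    coefficient of x^j off the values on [A]. *)
Lemma dual_monomial (A : {set F}) (j : nat) : (j < #|A|)%N ->
  exists L : F -> F, forall k, (k < #|A|)%N ->
    \sum_(x in A) L x * x ^+ k = (k == j)%:R.
Proof.
move=> jA; set N := #|A| in jA *.
pose a : 'rV[F]_N := \row_i enum_val i.
pose V := Vandermonde N a.
have Vu : V \in unitmx.
  rewrite unitmxE det_Vandermonde unitfE.
  apply/prodf_neq0 => i _; apply/prodf_neq0 => k ik; rewrite subr_eq0 !mxE.
  by apply: contraTneq ik => /enum_val_inj ->; rewrite ltnn.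
exists (fun x => \sum_(i < N | enum_val i == x) invmx V i (Ordinal jA)) => k kA.
rewrite big_enum_val /= -/N.
transitivity ((V *m invmx V) (Ordinal kA) (Ordinal jA)); last first.
  by rewrite mulmxV // mxE.
rewrite mxE; apply: eq_bigr => i _; rewrite !mxE mulrC; congr (_ * _).
by rewrite (big_pred1 i) // => i'; rewrite (inj_eq enum_val_inj).
Qed.

Lemma tensor_monomial s (A : 'I_s -> {set F}) (L : 'I_s -> F -> F)
    (r : 'I_s -> nat) :
  \prod_i \sum_(x in A i) L i x * x ^+ r i =
  \sum_(w in family A) (\prod_i L i (w i)) * \prod_i w i ^+ r i.
Proof.
by rewrite bigA_distr_big_dep; apply: eq_bigr => w _; rewrite -big_split.
Qed.

(* A form of degree [j] is determined by its restriction to [b ord0 = 1], where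
   it has degree less than [m] in each of the remaining variables. *)
Lemma form_vanishing_on_grid n m j (I : finType) (c : I -> F)
    (e : I -> 'X_{1..n.+1}) (A : 'I_n -> {set F}) :
  injective e -> (j < m)%N -> (forall i, m <= #|A i|)%N ->
  (forall b : 'I_n.+1 -> F, b ord0 = 1 -> (forall i, b (lift ord0 i) \in A i) ->
     \sum_(i | mdeg (e i) == j) c i * \prod_k b k ^+ e i k = 0) ->
  forall i, mdeg (e i) = j -> c i = 0.
Proof.
move=> e_inj jm mA vanish i0 di0.
have le_deg i k : mdeg (e i) = j -> (e i k < m)%N.
  by move=> d; apply: leq_ltn_trans jm; rewrite -d mdegE (bigD1 k) ?leq_addr.
pose B k := if unlift ord0 k is Some k' then A k' else [set 1].
have /fin_all_exists[L LP] : forall k : 'I_n.+1, exists L : F -> F,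
    forall i, mdeg (e i) = j -> \sum_(x in B k) L x * x ^+ e i k =
      ((k == ord0) || (e i k == e i0 k))%:R.
  move=> k; rewrite /B; case: unliftP => [k'|] ->.
    have [L LP] := @dual_monomial (A k') (e i0 (lift ord0 k'))
      (leq_trans (le_deg _ _ di0) (mA _)).
    exists L => i di; rewrite LP; last exact: leq_trans (le_deg _ _ di) (mA _).
    by [].
  exists (fun=> 1) => i di; rewrite big_set1 expr1n mulr1.
  by rewrite eqxx.
transitivity (\sum_(i | mdeg (e i) == j)
   c i * \prod_k \sum_(x in B k) L k x * x ^+ e i k).
  rewrite (bigD1 i0) ?di0 //= [X in c i0 * X]big1 => [|k _]; last first.
    by rewrite LP // eqxx orbT.
  rewrite mulr1 big1 ?addr0 // => i /andP[/eqP di ne].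
  apply/eqP; rewrite mulf_eq0; apply/orP; right; apply/prodf_eq0.
  (* Two exponents of the same degree that agree away from [ord0] also agree at [ord0], so a
     different exponent is detected by one of the other coordinates. *)
  have [k] : exists k, (k != ord0) && (e i k != e i0 k).
    apply/existsP; apply: contraNT ne; rewrite negb_exists => /forallP H.
    have tl k : e i (lift ord0 k) = e i0 (lift ord0 k).
      by have := H (lift ord0 k); rewrite eq_sym neq_lift => /negbNE/eqP.
    apply/eqP/e_inj/mnmP => k; case: (unliftP ord0 k) => [k'|] -> //.
    have := di; rewrite -{}di0 !mdegE !big_ord_recl.
    by rewrite (eq_bigr _ (fun k _ => tl k)) => /addIn.
  case/andP=> k0 nek; exists k => //; rewrite LP // (negbTE k0) (negbTE nek).
  by [].
under eq_bigr do rewrite tensor_monomial mulr_sumr.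
rewrite exchange_big big1 //= => b bB.
under eq_bigr do rewrite mulrCA.
rewrite -mulr_sumr vanish ?mulr0 //.
  by have /familyP/(_ ord0) := bB; rewrite /B unlift_none => /set1P.
by move=> i; have /familyP/(_ (lift ord0 i)) := bB; rewrite /B liftK.
Qed.

End Grid.

(** * Taylor expansion at a point and restriction to lines *)

Section Recenter.
Local Open Scope ring_scope.
Variables (F : finFieldType) (s : nat).
Implicit Types (P : {mpoly F[s]}) (w b : 'I_s -> F).

Definition recenter w P : {mpoly F[s]} :=
  P \mPo [tuple (w i)%:MP + 'X_i | i < s].

(** Evaluating the coefficients at x = [w] is a ring morphism, so it may be applied to P(x + z)
    before a coefficient in z is extracted. *)
Lemma hasse_meval P i w : (hasse P i).@[w] = (recenter w P)@_i.
Proof.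
rewrite /hasse -mcoeff_map_mpoly; congr (_@__).
rewrite /shiftP -[fun c : F => _]/(@mpolyC s F) /recenter.
set P' := map_mpoly _ P; pose N := maxn (msize P) (msize P').
rewrite (comp_mpolywE _ (w := N)) ?leq_maxr //.
rewrite [in RHS](comp_mpolywE _ (w := N)) ?leq_maxl // raddf_sum /=.
apply: eq_bigr => k _; rewrite map_mpolyZ mcoeff_map_mpoly/= mevalC rmorph_prod.
congr (_ *: _); apply: eq_bigr => l _; rewrite rmorphXn !tnth_mktuple rmorphD /=.
by rewrite map_mpolyC map_mpolyX /= mevalXU.
Qed.

Definition vanishes m P w :=
  forall i : 'X_{1..s}, (mdeg i < m)%N -> (recenter w P)@_i = 0.

Lemma hasse_vecE m P (w : mc_coord F s) (i : 'X_{1..s < m}) :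
  hasse_vec m P w i = (recenter w P)@_i.
Proof. by rewrite /hasse_vec ffunE hasse_meval. Qed.

Lemma hasse_vec_eq m P P' (w : mc_coord F s) :
  hasse_vec m P w = hasse_vec m P' w <-> vanishes m (P - P') w.
Proof.
have E (i : 'X_{1..s < m}) : hasse_vec m P w i = hasse_vec m P' w i <->
    (recenter w (P - P'))@_i = 0.
  rewrite /recenter raddfB mcoeffB; split=> [eq_i|/subr0_eq eq_i].
    by rewrite -(etrans (esym (hasse_vecE P w i)) (etrans eq_i (hasse_vecE P' w i)))
      subrr.
  exact: etrans (hasse_vecE P w i) (etrans eq_i (esym (hasse_vecE P' w i))).
split=> [/ffunP eq_PP' i im|van]; first exact/(E (BMultinom im))/eq_PP'.
by apply/ffunP => i; apply/E/van/bmdeg.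
Qed.

Definition restrict_line w b P : {poly F} :=
  mmap polyC (fun i => (w i)%:P + b i *: 'X) P.

Lemma restrict_line_recenter w b P :
  restrict_line w b P = mmap polyC (fun i => b i *: 'X) (recenter w P).
Proof.
rewrite /restrict_line /recenter comp_mpolyE raddf_sum /=.
apply: eq_bigr => m _; rewrite mmapZ rmorph_prod; congr (_ * _).
apply: eq_bigr => i _; rewrite rmorphXn /= tnth_mktuple rmorphD /=.
by rewrite mmapC mmapX mmap1U.
Qed.

Lemma restrict_line_shift w b P t :
  restrict_line w b P \Po ('X + t%:P) =
  restrict_line (fun i => w i + t * b i) b P.
Proof.
rewrite /restrict_line /mmap raddf_sum; apply: eq_bigr => m _.
rewrite /= comp_polyM comp_polyC rmorph_prod /=; congr (_ * _).
apply: eq_bigr => i _; rewrite rmorphXn rmorphD /= comp_polyC comp_polyZ.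
rewrite comp_polyX scalerDr -[b i *: t%:P]mul_polyC -polyCM [b i * t]mulrC.
by rewrite [_ *: 'X + _]addrC addrA -polyCD.
Qed.

Lemma coef_restrict_line w b P N j : (msize (recenter w P) <= N)%N ->
  (restrict_line w b P)`_j =
  \sum_(i : 'X_{1..s < N} | mdeg i == j)
     (recenter w P)@_i * \prod_k b k ^+ i k.
Proof.
move=> PN; rewrite restrict_line_recenter (mmapE N) // coef_sum [RHS]big_mkcond.
apply: eq_bigr => i _; rewrite coefCM /mmap1.
under [in LHS]eq_bigr do rewrite exprZn.
rewrite scaler_prod coefZ prodrXr -mdegE coefXn eq_sym.
by case: eqP; rewrite ?mulr1 ?mulr0.
Qed.

Lemma size_restrict_line w b P : (size (restrict_line w b P) <= msize P)%N.
Proof.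
apply: leq_trans (size_sum _ _ _) _.
apply/bigmax_leqP_seq => m /msize_mdeg_lt mP _; rewrite mul_polyC (leq_trans (size_scale_leq _ _)) //.
apply: leq_trans mP; rewrite mdegE /mmap1.
elim/big_rec2: _ => [|i d p _ IH]; first by rewrite size_poly1.
set l := _ + _; have sl : (size l <= 2)%N.
  rewrite (leq_trans (size_polyD _ _)) // geq_max.
  rewrite (leq_trans (size_polyC_leq1 _)) //.
  by rewrite (leq_trans (size_scale_leq _ _)) ?size_polyX.
have sX : (size (l ^+ m i) <= (m i).+1)%N.
  apply: leq_trans (size_poly_exp_leq _ _) _.
  by rewrite ltnS -{2}[m i]mul1n leq_mul2r -subn1 leq_subLR sl orbT.
rewrite (leq_trans (size_polyMleq _ _)) // -subn1 leq_subLR.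
by rewrite add1n -addnS -addSn leq_add.
Qed.

(** Translating the parameter by [t] moves the point to parameter 0, where the coefficients of T^j,
    j < m, are combinations of derivatives of order j. *)
Lemma dvd_restrict_line m w b P t :
  vanishes m P (fun i => w i + t * b i) ->
  ('X - t%:P) ^+ m %| restrict_line w b P.
Proof.
move=> van.
have -> : restrict_line w b P =
    restrict_line (fun i => w i + t * b i) b P \Po ('X - t%:P).
  by rewrite -restrict_line_shift -comp_polyA comp_polyD comp_polyC comp_polyX
             subrK comp_polyXr.
set p := restrict_line _ b P.
have -> : p = drop_poly m p * 'X^m.
  rewrite -[LHS](poly_take_drop m) (_ : take_poly m p = 0) ?add0r //.
  apply/polyP => j; rewrite coef_take_poly coef0; case: ifP => // jm.
  rewrite /p (coef_restrict_line _ _ (leqnn _)) big1 // => i /eqP ij.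
  by rewrite van ?mul0r // ij.
by rewrite comp_polyM comp_Xn_poly dvdp_mull.
Qed.

Lemma dvd_prod_XsubC_exp m (p : {poly F}) (r : seq F) : uniq r ->
    (forall t, t \in r -> ('X - t%:P) ^+ m %| p) ->
  \prod_(t <- r) ('X - t%:P) ^+ m %| p.
Proof.
elim: r => [|t r IH] /=; first by rewrite big_nil dvd1p.
move=> /andP[tr r_uniq] dvd_p; rewrite big_cons Gauss_dvdp; last first.
  rewrite coprimep_sym prodrXl coprimep_expl // coprimep_expr //.
  by rewrite coprimep_XsubC root_prod_XsubC.
rewrite dvd_p ?mem_head // IH // => u ur.
by rewrite dvd_p // in_cons ur orbT.
Qed.

(** As [msize] is one more than the degree of a nonzero polynomial, the bound keeps the degree
    strictly below m (q - 1), the degree of the product of the divisors. *)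
Lemma restrict_line_eq0 m w b P :
    (forall t, t != 0 -> vanishes m P (fun i => w i + t * b i)) ->
    (msize P <= m * #|F|.-1)%N ->
  restrict_line w b P = 0.
Proof.
move=> van sP; set p := restrict_line w b P.
pose r := enum [set~ 0 : F].
have p_dvd : \prod_(t <- r) ('X - t%:P) ^+ m %| p.
  apply: dvd_prod_XsubC_exp (enum_uniq _) _ => t.
  by rewrite mem_enum !inE => t0; apply/dvd_restrict_line/van.
have sz : size (\prod_(t <- r) ('X - t%:P) ^+ m) = (m * #|F|.-1).+1.
  rewrite prodrXl -(cardsC1 (0 : F)) cardE -/r mulnC.
  have := size_exp (\prod_(t <- r) ('X - t%:P)) m; rewrite size_prod_XsubC /=.
  move=> <-; rewrite prednK // size_poly_gt0.
  by rewrite expf_neq0 // -size_poly_gt0 size_prod_XsubC.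
apply/eqP; apply: contraTT p_dvd => p0; apply/negP => /(dvdp_leq p0).
by rewrite sz ltnNge (leq_trans (size_restrict_line _ _ _)).
Qed.

End Recenter.

(** * Disjoint recovering sets *)

Section Recovery.
Local Open Scope ring_scope.
Variable F : finFieldType.

Lemma eq_vanishes s m (P : {mpoly F[s]}) w w' :
  w =1 w' -> vanishes m P w -> vanishes m P w'.
Proof.
move=> eq_w van i im; rewrite -(van i im); congr ((_ \mPo _)@__).
by apply: eq_from_tnth => k; rewrite !tnth_mktuple eq_w.
Qed.

Lemma vanishes_center n m (P : {mpoly F[n.+1]}) w (A : 'I_n -> {set F}) :
    (msize P <= m * #|F|.-1)%N -> (forall i, m <= #|A i|)%N ->
    (forall t b, t != 0 -> b ord0 = 1 -> (forall i, b (lift ord0 i) \in A i) ->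
      vanishes m P (fun i => w i + t * b i)) ->
  vanishes m P w.
Proof.
move=> sP mA van i im.
(* [N] must bound the expansion at [w] and also make [i] itself an index. *)
pose N := maxn (msize (recenter w P)) (mdeg i).+1.
have iN : (mdeg i < N)%N by rewrite leq_maxr.
pose c (k : 'X_{1..n.+1 < N}) := (recenter w P)@_k.
apply: (@form_vanishing_on_grid F n m (mdeg i) _ c val A val_inj im mA _
  (BMultinom iN)) => //.
move=> b b0 bA; rewrite -coef_restrict_line ?leq_maxl //.
by rewrite (restrict_line_eq0 _ sP) ?coef0 // => t t0; apply: van.
Qed.

(** For positive [m], a run of consecutive elements in the enumeration of [F]; the runs with
    [j < #|F| %/ m] are full. *)
Definition block m j : {set F} := [set x | (enum_rank x %/ m == j)%N].

Lemma card_block m j : (j < #|F| %/ m)%N -> (m <= #|block m j|)%N.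
Proof.
move=> jq; have [->|m_gt0] := posnP m; first by [].
have lt_q (i : 'I_m) : (j * m + i < #|F|)%N.
  apply: (@leq_trans (j.+1 * m)); first by rewrite mulSn addnC ltn_add2r.
  by rewrite (leq_trans _ (leq_trunc_div #|F| m)) // leq_mul2r jq orbT.
rewrite -[X in (X <= _)%N]card_ord.
rewrite -(card_imset _ (f := fun i => enum_val (Ordinal (lt_q i)))).
  apply/subset_leq_card/subsetP => _ /imsetP[i _ ->].
  by rewrite inE enum_valK /= divnMDl // divn_small ?addn0.
by move=> i k /enum_val_inj [/addnI /val_inj].
Qed.

Variables (n m : nat).
Implicit Type w : mc_coord F n.+1.

(** The points w + t b with t nonzero, b normalized to 1 at [ord0] and its other entries in the
    blocks chosen by [u]. A point determines t and b, hence [u]. *)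
Definition cone w (u : {ffun 'I_n -> 'I_(#|F| %/ m)}) :=
  [set v : mc_coord F n.+1 | (v ord0 != w ord0) &&
    [forall i, (v (lift ord0 i) - w (lift ord0 i)) / (v ord0 - w ord0)
                 \in block m (u i)]].

Lemma cone_disjoint w u u' : u != u' -> [disjoint cone w u & cone w u'].
Proof.
apply: contraNT; rewrite -setI_eq0 => /set0Pn[v]; rewrite !inE.
case/andP=> /andP[_ /forallP vu] /andP[_ /forallP vu'].
apply/eqP/ffunP => i; apply: val_inj.
have := vu i; have := vu' i; rewrite !inE => /eqP vi /eqP; rewrite vi => ui.
exact: esym.
Qed.

Lemma vanishes_cone (P : {mpoly F[n.+1]}) w u : (msize P <= m * #|F|.-1)%N ->
  (forall v, v \in cone w u -> vanishes m P v) -> vanishes m P w.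
Proof.
move=> sP van; apply: (vanishes_center (A := fun i => block m (u i))) => //.
  by move=> i; apply: card_block.
move=> t b t0 b0 bA.
apply: (eq_vanishes (w := [ffun i => w i + t * b i])) => [i|]; first exact: ffunE.
apply: van; rewrite inE !ffunE b0 mulr1 addrC -subr_eq0 addrK t0.
by apply/forallP => i; rewrite !ffunE [_ + t * _]addrC addrK mulrAC divff ?mul1r.
Qed.

End Recovery.

(** The decoder searches the finite code for a word agreeing with its input on [R] and reads that
    word at [w]; [c0] is the default when there is none. *)
Lemma recoverable_from_set (T A : finType) (S : {set {ffun T -> A}})
    (C : {ffun T -> A} -> Prop) (w : T) (R : {set T}) (c0 : {ffun T -> A}) :
    (forall c, c \in S <-> C c) ->
    (forall c c', C c -> C c' -> {in R, c =1 c'} -> c w = c' w) ->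
  recoverable_from C w R.
Proof.
move=> SC rec.
exists (fun c =>
  odflt c0 [pick c' in S | [forall v in R, c' v == c v]] w); split.
  move=> c c' eq_cc'; congr ((_ : {ffun T -> A}) w); congr odflt.
  apply: eq_pick => e /=.
  congr (_ && _); apply: eq_forallb => v.
  by case: (boolP (v \in R)) => //= /eq_cc' ->.
move=> c Cc; case: pickP => [c' /andP[/SC Cc' /forall_inP eq_cc']|/(_ c)] /=.
  by apply: rec => // v /eq_cc'/eqP.
by have /SC-> := Cc; move=> /= /forall_inP[].
Qed.

(** * Injectivity of the encoding *)

Section Injectivity.
Local Open Scope ring_scope.
Variables (F : finFieldType) (s : nat).
Implicit Types (P : {mpoly F[s]}) (e : 'X_{1..s}) (w : 'I_s -> F).

(** The part of top degree is exactly ['X_[e]]; all the rest has smaller degree. *)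
Definition led_by P e := (msize (P - 'X_[e]) <= mdeg e)%N.

Lemma led_by_msize P e : led_by P e -> (msize P <= (mdeg e).+1)%N.
Proof.
move=> Pe; rewrite -[P](subrK 'X_[e]) (leq_trans (msizeD_le _ _)) // geq_max.
by rewrite (leqW (Pe : (_ <= _)%N)) msizeX /=.
Qed.

Lemma msizeM_leq P Q a b : (msize P <= a)%N -> (msize Q <= b.+1)%N ->
  (msize (P * Q) <= a + b)%N.
Proof.
have [->|P0] := eqVneq P 0; first by rewrite mul0r msize0.
have [->|Q0] := eqVneq Q 0; first by rewrite mulr0 msize0.
by move=> Pa Qb; rewrite msizeM // -subn1 leq_subLR add1n -addnS leq_add.
Qed.

Lemma led_by1 : led_by 1 0%MM.
Proof. by rewrite /led_by mpolyX0 subrr msize0. Qed.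

Lemma led_byM P Q e f : led_by P e -> led_by Q f -> led_by (P * Q) (e + f)%MM.
Proof.
move=> Pe Qf; rewrite /led_by mpolyXD mdegD.
rewrite (_ : _ - _ = (P - 'X_[e]) * Q + (Q - 'X_[f]) * 'X_[e]); last first.
  by rewrite !mulrBl [Q * _]mulrC addrA subrK ['X_[f] * _]mulrC.
rewrite (leq_trans (msizeD_le _ _)) // geq_max.
rewrite msizeM_leq ?(led_by_msize Qf) // addnC.
by rewrite msizeM_leq ?msizeX.
Qed.

Lemma led_by_prod (I : Type) (r : seq I) (P : I -> {mpoly F[s]}) (e : I -> _) :
  (forall i, led_by (P i) (e i)) ->
  led_by (\prod_(i <- r) P i) (\sum_(i <- r) e i)%MM.
Proof.
move=> H; elim/big_rec2: _ => [|i f Q _ IH]; first exact: led_by1.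
exact: led_byM.
Qed.

Lemma led_byX P e k : led_by P e -> led_by (P ^+ k) (e *+ k)%MM.
Proof.
move=> H; elim: k => [|k IH]; first by rewrite expr0 mulm0n; apply: led_by1.
by rewrite exprS mulmS; apply: led_byM.
Qed.

Definition quom e := [multinom (e i %/ #|F|)%N | i < s].

(* The univariate factor [\prod_c ('X - c) = 'X^q - 'X] is invariant under the
   translations by F and vanishes to order exactly 1 at each of its points. *)
Definition split_monomial e : {mpoly F[s]} :=
  \prod_i ((\prod_(c : F) ('X_i - c%:MP)) ^+ (e i %/ #|F|) *
           'X_i ^+ (e i %% #|F|)).

Lemma split_monomial_led e : led_by (split_monomial e) e.
Proof.
have XsubC_led i : led_by (\prod_(c : F) ('X_i - c%:MP)) (U_(i) *+ #|F|).
  rewrite (_ : (U_(i) *+ #|F| = \sum_(c : F) U_(i))%MM).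
    apply: led_by_prod => c; rewrite /led_by addrAC subrr add0r msizeN msizeC.
    by rewrite mdeg1 leq_b1.
  by apply/mnmP => k; rewrite mulmnE mnm_sumE sum_nat_const mulnC.
rewrite {2}[e](_ : _ = \sum_(i < s) (U_(i) *+ #|F| *+ (e i %/ #|F|) +
    U_(i) *+ (e i %% #|F|)))%MM.
  apply: led_by_prod => i; apply/led_byM/led_byX; first exact/led_byX.
  by rewrite /led_by subrr msize0.
rewrite {1}[e]multinomUE_id; apply: eq_bigr => i _; apply/mnmP => k.
by rewrite mnmDE !mulmnE -mulnA -mulnDr [(#|F| * _)%N]mulnC -divn_eq.
Qed.

Lemma split_monomial_span N n P : (msize P <= n)%N -> (n <= N)%N ->
  exists c : 'X_{1..s} -> F,
    P = \sum_(e : 'X_{1..s < N}) c e *: split_monomial e.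
Proof.
elim: n P => [|n IH] P sP nN.
  exists (fun=> 0); move: sP; rewrite leqn0 msize_poly_eq0 => /eqP ->.
  by rewrite big1 // => e _; rewrite scale0r.
(* Each monomial of [P] is replaced by its difference with a split monomial, of smaller degree, so
   the bound drops from [n.+1] to [n]. *)
pose P' := P - \sum_(e : 'X_{1..s < N}) P@_e *: split_monomial e.
have [|c cP'] := IH P' _ (ltnW nN).
  rewrite /P' {1}(mpolywE (leq_trans sP nN)) -sumrB.
  apply: leq_trans (msize_sum _ _ _) _; apply/bigmax_leqP => e _.
  rewrite -scalerBr; have [->|Pe] := eqVneq P@_e 0.
    by rewrite scale0r msize0.
  rewrite (leq_trans (msizeZ_le _ _)) // -msizeN opprB.
  apply: leq_trans (split_monomial_led e) _.
  by rewrite -ltnS (leq_trans _ sP) // msize_mdeg_lt // mcoeff_msupp.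
exists (fun e => P@_e + c e); rewrite -[P in LHS](subrK
  (\sum_(e : 'X_{1..s < N}) P@_e *: split_monomial e)) -/P' cP' -big_split.
by apply: eq_bigr => e _ /=; rewrite scalerDl addrC.
Qed.

(** The constant term of X^(q-1) - 1, the product of the X - c over nonzero c. *)
Definition wilson : F := \prod_(c : F | c != 0) - c.

Lemma recenter_split_monomial w e :
  exists2 H : {mpoly F[s]}, recenter w (split_monomial e) = H * 'X_[quom e] &
    H@_0 = wilson ^+ mdeg (quom e) * \prod_i w i ^+ (e i %% #|F|).
Proof.
pose H := \prod_i ((\prod_(c : F | c != 0) ('X_i - c%:MP)) ^+ (e i %/ #|F|) *
                   ((w i)%:MP + 'X_i) ^+ (e i %% #|F|)) : {mpoly F[s]}.
exists H.
  rewrite mpolyXE_id -big_split /recenter rmorph_prod; apply: eq_bigr => i _ /=.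
  have XE : 'X_i \mPo [tuple (w i)%:MP + 'X_i | i < s] = (w i)%:MP + 'X_i.
    by rewrite comp_mpolyXU -tnth_nth tnth_mktuple.
  rewrite rmorphM !rmorphXn /= XE mnmE mulrAC -exprMn; congr (_ ^+ _ * _).
  (* Shifting c by [w i] cancels the translation; the factor c = 0 becomes ['X_i], and the others
     have constant terms -c. *)
  rewrite rmorph_prod (reindex_inj (addrI (w i))) /= (bigD1 0) //= mulrC.
  under eq_bigr do rewrite rmorphB /= XE comp_mpolyC mpolyCD opprD addrACA subrr
    add0r.
  by rewrite rmorphB /= XE comp_mpolyC addr0 addrAC subrr add0r.
have X0 i : ('X_i : {mpoly F[s]})@_0 = 0 by rewrite mcoeffX mnm1_eq0.
have C0 c : (c%:MP : {mpoly F[s]})@_0 = c by rewrite mcoeffC eqxx mulr1.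
rewrite /H rmorph_prod mdegE -prodrXr -big_split; apply: eq_bigr => i _ /=.
rewrite rmorphM !rmorphXn rmorph_prod rmorphD /= X0 C0 addr0 mnmE.
by congr (_ ^+ _ * _); apply: eq_bigr => c _; rewrite rmorphB /= X0 C0 sub0r.
Qed.

Lemma wilson_neq0 : wilson != 0.
Proof. by apply/prodf_neq0 => c; rewrite oppr_eq0. Qed.

Lemma vanishes_everywhere m P : (msize P <= m * #|F|)%N ->
  (forall w, vanishes m P w) -> P = 0.
Proof.
move=> sP van; have [c cP] := split_monomial_span sP (leqnn _).
set N := (m * #|F|)%N in cP.
suff c0 t (e : 'X_{1..s < N}) : mdeg (quom e) = t -> c e = 0.
  by rewrite cP big1 // => e _; rewrite (c0 _ e erefl) scale0r.
elim/ltn_ind: t e => t IH e0 dt; pose k := quom e0.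
(* Since q |k| <= |e0| < m q. *)
have lt_km : (mdeg k < m)%N.
  rewrite -(ltn_pmul2r (m := #|F|)) ?(leq_ltn_trans _ (bmdeg e0)) //; last first.
    by apply/card_gt0P; exists 0.
  rewrite !mdegE big_distrl /=; apply: leq_sum => i _.
  by rewrite mnmE leq_trunc_div.
(* If |quom e| < t, the induction hypothesis kills [c e]. Otherwise |quom e| is at least |k|, so
   ['X_[quom e]] divides ['X_[k]] only when [quom e] is [k]. *)
have coefE w (e : 'X_{1..s < N}) : c e * (recenter w (split_monomial e))@_k =
    if quom e == k
    then wilson ^+ t * (c e * \prod_i w i ^+ (e i %% #|F|)) else 0.
  have [H -> H0] := recenter_split_monomial w e.
  case: eqP => [ek|/eqP nek].
    by rewrite -ek -[X in _@_X]addm0 mcoeffMX H0 ek dt mulrCA.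
  have [lt_t|le_t] := ltnP (mdeg (quom e)) t; first by rewrite (IH _ lt_t) // mul0r.
  apply/eqP; rewrite mulf_eq0 mcoeff_eq0 (perm_mem (msuppMX _ _)).
  apply/orP; right; apply/mapP => -[f _ kE]; case/negP: nek.
  have : mdeg k = t by []. rewrite kE mdegD => df.
  have /eqP f0 : f == 0%MM by rewrite -mdeg_eq0 -leqn0 -(leq_add2l t) addn0 -{2}df leq_add2r.
  by apply/eqP; rewrite -[LHS]addm0 -f0 -kE.
have reduced_eq0 w : \sum_(e : 'X_{1..s < N} | quom e == k)
    c e * \prod_i w i ^+ (e i %% #|F|) = 0.
  apply: (mulfI (expf_neq0 t wilson_neq0)); rewrite mulr0 mulr_sumr.
  rewrite big_mkcond -[RHS](van w k lt_km) cP /recenter.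
  rewrite (raddf_sum (comp_mpoly _)) (raddf_sum (mcoeff k)).
  apply: eq_bigr => e _; rewrite -coefE -mcoeffZ; congr (_@__).
  exact: esym (comp_mpolyZ _ _ _).
(* Residues modulo q are below [#|F|], so the whole field serves as the interpolation set and
   isolates the residues of [e0]. *)
have /fin_all_exists[L LP] (i : 'I_s) : exists L : F -> F, forall j : nat,
    \sum_(x in [set: F]) L x * x ^+ (j %% #|F|) = ((j %% #|F|)%N == (e0 i %% #|F|)%N)%:R.
  have F_gt0 : (0 < #|[set: F]|)%N by apply/card_gt0P; exists 0.
  have lt_F j : (j %% #|F| < #|[set: F]|)%N by rewrite cardsT ltn_mod -cardsT.
  by have [L LP] := dual_monomial (lt_F (e0 i)); exists L => j; apply: LP.
transitivity (\sum_(e : 'X_{1..s < N} | quom e == k)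
    c e * \prod_i \sum_(x in [set: F]) L i x * x ^+ (e i %% #|F|)).
  rewrite (bigD1 e0) //= [X in c e0 * X]big1 => [|i _]; last by rewrite LP eqxx.
  rewrite mulr1 big1 ?addr0 // => e /andP[/eqP ek ne].
  apply/eqP; rewrite mulf_eq0; apply/orP; right; apply/prodf_eq0.
  have [i ne_i] : exists i, (e i %% #|F| != e0 i %% #|F|)%N.
    apply/existsP; apply: contraNT ne; rewrite negb_exists => /forallP eq_r.
    apply/eqP/val_inj/mnmP => i.
    have := congr1 (fun f : 'X_{1..s} => f i) ek; rewrite !mnmE => eq_q.
    by rewrite (divn_eq (e i) #|F|) eq_q (eqP (negbNE (eq_r i))) -divn_eq.
  by exists i => //; rewrite LP (negbTE ne_i).
under eq_bigr do rewrite tensor_monomial mulr_sumr.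
rewrite exchange_big big1 //= => w _.
under eq_bigr do rewrite mulrCA.
by rewrite -mulr_sumr reduced_eq0 mulr0.
Qed.

End Injectivity.

(** * Counting exponents and clearing the denominator *)

Section Counting.

Lemma card_bmultinom s n : #|{: 'X_{1..s < n.+1}}| = 'C(s + n, s).
Proof.
rewrite -card_partial_ord_partitions -cardsT.
pose f (e : 'X_{1..s < n.+1}) : s.-tuple 'I_n.+1 := [tuple inord (e i) | i < s].
have le_n (e : 'X_{1..s < n.+1}) i : e i < n.+1.
  by apply: leq_ltn_trans (bmdeg e); rewrite mdegE (bigD1 i) ?leq_addr.
have fE e i : tnth (f e) i = e i :> nat by rewrite tnth_mktuple inordK.
have f_inj : injective f.
  by move=> e e' ff'; apply/val_inj/mnmP => i; rewrite -!fE ff'.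
rewrite -(card_imset _ f_inj); apply: eq_card => t; rewrite inE.
apply/imsetP/idP => [[e _ ->]|le_tn].
  by rewrite -ltnS big_tuple (eq_bigr _ (fun i _ => fE e i)) -mdegE bmdeg.
have lt_t : mdeg [multinom (tnth t i : nat) | i < s] < n.+1.
  rewrite mdegE ltnS; move: le_tn; rewrite big_tuple.
  by under [in X in _ -> X]eq_bigr do rewrite mnmE.
exists (BMultinom lt_t) => //; apply: eq_from_tnth => i.
by apply: ord_inj; rewrite fE /= mnmE.
Qed.

Lemma mc_degree_bound (d m q : nat) : 0 < m -> 0 < q ->
  (d%:Q / m%:Q < q%:Q - 1)%R -> d < m * q.-1.
Proof.
move=> m_gt0; case: q => // q _; rewrite ltr_pdivrMr ?ltr0z //.
rewrite -addn1 PoszD intrD addrK -intrM ltr_int -PoszM ltz_nat.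
by rewrite addn1 mulnC.
Qed.

End Counting.

(** * The code as a finite set, and its cardinality *)

Section Code.
Local Open Scope ring_scope.
Variables (F : finFieldType) (m d s : nat).

Lemma mult_encode_eq (P P' : {mpoly F[s]}) (w : mc_coord F s) :
  mult_encode m P w = mult_encode m P' w <-> vanishes m (P - P') w.
Proof.
have E Q : mult_encode m Q w = hasse_vec m Q w by rewrite /mult_encode ffunE.
rewrite -hasse_vec_eq; split=> eqw.
  exact: etrans (esym (E P)) (etrans eqw (E P')).
exact: etrans (E P) (etrans eqw (esym (E P'))).
Qed.

Lemma mult_encode_inj (P P' : {mpoly F[s]}) : (d < m * #|F|)%N ->
    (msize P <= d.+1)%N -> (msize P' <= d.+1)%N ->
  mult_encode m P = mult_encode m P' -> P = P'.
Proof.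
move=> lt_d sP sP' /ffunP eq_PP'; apply/eqP; rewrite -subr_eq0; apply/eqP.
apply: (@vanishes_everywhere _ _ m) => [|w].
  by rewrite (leq_trans _ lt_d) // (leq_trans (msizeD_le _ _)) // msizeN geq_max sP.
apply: (eq_vanishes (w := finfun w)) => [i|]; first exact: ffunE.
exact/mult_encode_eq/eq_PP'.
Qed.

(** A finite parametrization of the message polynomials, so that the code is an image that can be
    counted. *)
Definition bounded_mpoly (c : {ffun 'X_{1..s < d.+1} -> F}) : {mpoly F[s]} :=
  \sum_e c e *: 'X_[e].

Lemma msize_bounded_mpoly c : (msize (bounded_mpoly c) <= d.+1)%N.
Proof.
apply: leq_trans (msize_sum _ _ _) _; apply/bigmax_leqP => e _.
by rewrite (leq_trans (msizeZ_le _ _)) // msizeX bmdeg.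
Qed.

Lemma bounded_mpoly_inj : injective bounded_mpoly.
Proof.
move=> c c' eq_cc'; apply/ffunP => e.
have coefE (b : {ffun 'X_{1..s < d.+1} -> F}) : (bounded_mpoly b)@_e = b e.
  rewrite raddf_sum (bigD1 e) //= big1 => [|f ne].
    by rewrite mcoeffZ mcoeffX eqxx mulr1 addr0.
  by rewrite mcoeffZ mcoeffX (inj_eq val_inj) (negbTE ne) mulr0.
by rewrite -!coefE eq_cc'.
Qed.

Lemma bounded_mpolyP (P : {mpoly F[s]}) : (msize P <= d.+1)%N ->
  exists c, P = bounded_mpoly c.
Proof.
move=> sP; exists [ffun e : 'X_{1..s < d.+1} => P@_e].
by rewrite {1}(mpolywE sP); apply: eq_bigr => e _; rewrite ffunE.
Qed.

Definition code_set : {set mc_word F m s} :=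
  [set mult_encode m (bounded_mpoly c) | c in {ffun 'X_{1..s < d.+1} -> F}].

Lemma code_setP c : c \in code_set <-> mult_code d c.
Proof.
split=> [/imsetP[b _ ->]|[P [/bounded_mpolyP[b ->] ->]]].
  by exists (bounded_mpoly b); rewrite msize_bounded_mpoly.
exact: imset_f.
Qed.

Lemma card_code_set : (d < m * #|F|)%N -> #|code_set| = (#|F| ^ 'C(s + d, s))%N.
Proof.
move=> lt_d; rewrite /code_set card_imset => [|b c eq_bc].
  by rewrite card_ffun card_bmultinom.
apply: bounded_mpoly_inj.
exact: mult_encode_inj lt_d (msize_bounded_mpoly b) (msize_bounded_mpoly c) eq_bc.
Qed.

End Code.

(** If two codewords agree on the cone, the difference of their polynomials vanishes to order [m]
    there, hence at [w]. *)
Lemma mult_code_recoverable (F : finFieldType) (m d n : nat)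
    (w : mc_coord F n.+1) (u : {ffun 'I_n -> 'I_(#|F| %/ m)}) :
  d < m * #|F|.-1 -> recoverable_from (@mult_code F m d n.+1) w (cone w u).
Proof.
move=> lt_d; apply: (recoverable_from_set [ffun=> [ffun=> 0%R]]) => [c|].
  exact: code_setP.
move=> _ _ [P [sP ->]] [P' [sP' ->]] eq_PP'.
apply/mult_encode_eq/(vanishes_cone (u := u)) => [|v vR].
  by rewrite (leq_trans _ lt_d) // (leq_trans (msizeD_le _ _)) // msizeN geq_max sP.
exact/mult_encode_eq/eq_PP'.
Qed.

Theorem theorem2 (F : finFieldType) (m d s q : nat) :
  (0 < m)%N -> (0 < d)%N -> (0 < s)%N -> #|F| = q ->
  ((d%:Q / m%:Q) < (q%:Q - 1))%R ->
  let r := 'C(s + m - 1, s) in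
  let Q := (q ^ r)%N in
  let k := ((q %/ m) ^ (s - 1))%N in
  (* length N = q^s *)
  #|mc_coord F s| = (q ^ s)%N /\
  (* mc_alphabet size Q = q^binom(s+m-1,s) *)
  #|mc_alphabet F m s| = Q /\
  (* n = log_Q |C| = binom(d+s,s)/binom(s+m-1,s), i.e. |C|^r = Q^binom(d+s,s) *)
  (exists S : {set mc_word F m s},
      (forall c, c \in S <-> mult_code d c) /\
      (#|S| ^ r)%N = (Q ^ 'C(d + s, s))%N) /\
  (* k-PIR *)
  PIR_property (@mult_code F m d s) k.
Proof.
move=> m_gt0 _ s_gt0 <- lt_dm r Q k.
have F_gt0 : 0 < #|F| by apply/card_gt0P; exists 0%R.
have lt_d := mc_degree_bound m_gt0 F_gt0 lt_dm.
split; first by rewrite card_ffun card_ord.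
split.
  rewrite card_ffun /Q /r; congr (_ ^ _).
  by case: m m_gt0 {lt_dm lt_d r Q k} => // m' _; rewrite card_bmultinom addnS subn1.
split.
  exists (code_set F m d s); split=> [c|]; first exact: code_setP.
  rewrite card_code_set; last by rewrite (leq_trans lt_d) // leq_mul2l leq_pred orbT.
  by rewrite /Q -!expnM mulnC [d + s]addnC.
case: s s_gt0 @r @Q @k => // n _ r Q k w.
(* There is one cone per [u]: [ord0] normalizes the direction, and each of the other s - 1
   coordinates chooses a block. *)
have card_k : #|{ffun 'I_n -> 'I_(#|F| %/ m)}| = k.
  by rewrite card_ffun !card_ord /k subn1.
pose u (j : 'I_k) := enum_val (cast_ord (esym card_k) j).
exists (fun j => cone w (u j)); split=> [j1 j2 ne|j].
  by apply: cone_disjoint; rewrite (inj_eq enum_val_inj) (inj_eq (@cast_ord_inj _ _ _)).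
exact: mult_code_recoverable.
Qed.
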